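(* Let $\Omega\subset\mathbb{R}^n$ be a bounded, connected, open set, let $1<p<\infty$, let $v$ be a non-negative measurable function on $\Omega$, and let $Q$ be a symmetric, positive semidefinite, measurable $n\times n$ matrix function on $\Omega$ with $|Q|_{\mathrm{op}}\in L^{p/2}_{\mathrm{loc}}(\Omega)$. Suppose the pair $(v,Q)$ has the $p$-Sobolev property and the $p$-Dirichlet property on $\Omega$. Let $F\in L^\infty(v,\Omega)$ be non-negative and let $\mathbf{t}$ be a degenerate subunit vector field. Then there is a positive constant $c_1$ such that for all $f,g\in L^p(v,\Omega)$, every degenerate weak solution $(u,\nabla u)\in QH^{1,p}_0(v,\Omega)$ of the Dirichlet problem with data $F,\mathbf{t},f,g$ satisfies $$\|\nabla u\|_{QL^p(\Omega)}\le c_1\left[\|f\|_{L^p(v,\Omega)}+\|g\|_{L^p(v,\Omega)}\right];$$ that is, $c_1$ is independent of $(u,\nabla u)$, $f$ and $g$.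
   Context: Here $|Q(x)|_{\mathrm{op}}=\sup_{|\xi|=1}|Q(x)\xi|$. The weight $v$ is not assumed to be locally integrable. Spaces. $L^p(v,\Omega)$ is the space of measurable functions $f$ with $\|f\|_{L^p(v,\Omega)}=(\int_\Omega |f|^p\,v\,dx)^{1/p}<\infty$ (functions equal $v\,dx$-a.e. identified); $L^\infty(v,\Omega)$ is the space of functions essentially bounded with respect to $v\,dx$. $QL^p(\Omega)$ is the space of measurable $\mathbf{f}:\Omega\to\mathbb{R}^n$ with $\|\mathbf{f}\|_{QL^p(\Omega)}=(\int_\Omega|\sqrt{Q}\,\mathbf{f}|^p\,dx)^{1/p}<\infty$ (with $\mathbf f,\mathbf g$ identified when $\sqrt Q\mathbf f=\sqrt Q\mathbf g$ a.e.). Both are separable reflexive Banach spaces. $\mathrm{Lip}_{\mathrm{loc}}(\Omega)$ is the set of functions that are Lipschitz on compact subsets of $\Omega$; $\mathrm{Lip}_0(\Omega)$ is the set of those with compact support in $\Omega$. $Q\mathrm{Lip}(v,\Omega)$ is the set of $\varphi\in\mathrm{Lip}_{\mathrm{loc}}(\Omega)$ with $\|\varphi\|_{QH^{1,p}(v,\Omega)}=\|\varphi\|_{L^p(v,\Omega)}+\|\nabla\varphi\|_{QL^p(\Omega)}<\infty$, and $Q\mathrm{Lip}_0(v,\Omega)=\mathrm{Lip}_0(\Omega)\cap Q\mathrm{Lip}(v,\Omega)$. $QH^{1,p}_0(v,\Omega)$ is the closure of $\{(\varphi,\nabla\varphi):\varphi\in Q\mathrm{Lip}_0(v,\Omega)\}$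 in $L^p(v,\Omega)\oplus QL^p(\Omega)$; its elements are written as pairs $(u,\nabla u)$, where $\nabla u$ denotes the second component (it need not be a distributional gradient nor be determined by $u$). $p$-Sobolev property: there is a constant $S(p,1)>0$ such that for all $\varphi\in Q\mathrm{Lip}_0(v,\Omega)$, $\left(\int_\Omega|\varphi|^p\,v\,dx\right)^{1/p}\le S(p,1)\left(\int_\Omega|\sqrt{Q}\nabla\varphi|^p\,dx\right)^{1/p}$. Admissible data: $f,g\in L^p(v,\Omega)$; $F\in L^\infty(v,\Omega)$ non-negative; and $\mathbf{t}:\Omega\to\mathbb{R}^n$ a (measurable) degenerate subunit vector field, i.e. there is a constant $C(\mathbf{t})$ with $\|\mathbf{t}\cdot\nabla\varphi\|_{L^p(v,\Omega)}\le C(\mathbf{t})\|\nabla\varphi\|_{QL^p(\Omega)}$ for all $\varphi\in Q\mathrm{Lip}_0(v,\Omega)$. Dirichlet problem: $-v^{-1}\mathrm{div}(|\sqrt{Q}\nabla u|^{p-2}Q\nabla u)+F|u|^{p-2}u=|f|^{p-2}f-v^{-1}\mathrm{div}(v|g|^{p-2}g\,\mathbf{t})$ in $\Omega$, $u=0$ on $\partial\Omega$. A pair $(u,\nabla u)\in QH^{1,p}_0(v,\Omega)$ is a degenerate weak solution if for all $\varphi\in Q\mathrm{Lip}_0(v,\Omega)$, $$\int_\Omega|\sqrt{Q}\nabla u|^{p-2}Q\nabla u\cdot\nabla\varphi\,dx+\int_\Omega F|u|^{p-2}u\,\varphi\,v\,dx=\int_\Omega|f|^{p-2}f\varphi\,v\,dx+\int_\Omega|g|^{p-2}g\,\mathbf{t}\cdot\nabla\varphi\,v\,dx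 .$$ (Expressions $|a|^{p-2}a$ are read as $0$ when $a=0$.) $p$-Dirichlet property: for all admissible $F,\mathbf{t},f,g$ there exists a degenerate weak solution $(u,\nabla u)\in QH^{1,p}_0(v,\Omega)$ of the Dirichlet problem; moreover, any degenerate weak solution $(u,\nabla u)\in QH^{1,p}_0(v,\Omega)$ is regular, that is, there is a positive constant $c_0$ such that $\|u\|_{L^p(v,\Omega)}\le c_0\left[\|f\|_{L^p(v,\Omega)}+\|g\|_{L^p(v,\Omega)}\right]$, where $c_0$ does not depend on $f$, $g$ or $(u,\nabla u)$ (it may depend on $p,v,Q,\Omega,F,\mathbf{t}$). *)

(* Defs.v *)
From HB Require Import structures.
From mathcomp Require Import all_boot all_order all_algebra.
From mathcomp Require Import all_classical all_reals all_analysis.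

Set Implicit Arguments.
Unset Strict Implicit.
Unset Printing Implicit Defensive.

Import Order.TTheory GRing.Theory Num.Theory.
Import numFieldNormedType.Exports.

Local Open Scope classical_set_scope.
Local Open Scope ring_scope.

(* Points of R^n are row vectors 'rV[R]_n.+1 (so the dimension is at least 1
   and the topology is the library's), vectors are columns 'cV[R]_n.+1, on
   which matrices act by *m.  The library norm of 'rV is the sup norm; it is
   used only for topological and Lipschitz notions, all Euclidean lengths go
   through [enorm]. *)

Section lebesgue_measure_Rn.
Context {R : realType} {n : nat}.
Local Open Scope ereal_scope.

Definition box (c : 'rV[R]_n.+1 * 'rV[R]_n.+1) : set 'rV[R]_n.+1 :=
  [set x | forall i, (c.1 ord0 i < x ord0 i <= c.2 ord0 i)%R].

Definition box_vol (c : 'rV[R]_n.+1 * 'rV[R]_n.+1) : R :=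
  (\prod_i Num.max 0 (c.2 ord0 i - c.1 ord0 i))%R.

Definition box_cover (A : set 'rV[R]_n.+1)
    : set (nat -> 'rV[R]_n.+1 * 'rV[R]_n.+1) :=
  [set c | A `<=` \bigcup_k box (c k)].

Definition lebesgue_outer (A : set 'rV[R]_n.+1) : \bar R :=
  ereal_inf [set \sum_(k <oo) (box_vol (c k))%:E | c in box_cover A].

Lemma box_vol_ge0 c : (0 <= box_vol c)%R.
Proof. by apply: prodr_ge0 => i _; rewrite le_max lexx. Qed.

Let vol_ge0 c : 0 <= (box_vol c)%:E.
Proof. by rewrite lee_fin box_vol_ge0. Qed.

Lemma lebesgue_outer_ge0 A : 0 <= lebesgue_outer A.
Proof. by apply: le_ereal_inf_tmp => x [c _ <-]; apply: nneseries_ge0. Qed.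

Lemma lebesgue_outer0 : lebesgue_outer set0 = 0.
Proof.
apply/eqP; rewrite eq_le lebesgue_outer_ge0 andbT.
apply: ereal_inf_lbound; exists (fun=> (0, 0)%R) => //=.
apply: eseries0 => k _ _ /=.
by rewrite /box_vol big_ord_recl /= !mxE subrr maxxx mul0r.
Qed.

Lemma le_lebesgue_outer :
  {homo lebesgue_outer : A B / A `<=` B >-> A <= B}.
Proof.
move=> A B AB; apply/ereal_inf_le_tmp => x [c cB <-].
by exists c => //; exact: subset_trans cB.
Qed.

Lemma lebesgue_outer_sigma_subadditive : sigma_subadditive lebesgue_outer.
Proof.
move=> A; have [[i ioo]|] := pselect (exists i, lebesgue_outer (A i) = +oo).
  rewrite (eseries_pinfty _ _ ioo) ?leey// => k _.
  by rewrite -ltNye (lt_le_trans _ (lebesgue_outer_ge0 _)).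
rewrite -forallNE => Aoo.
suff add2e (e : {posnum R}) : lebesgue_outer (\bigcup_n A n) <=
    \sum_(i <oo) lebesgue_outer (A i) + e%:num%:E.
  by apply/lee_addgt0Pr => _/posnumP[].
rewrite (le_trans _ (epsilon_trick _ _ _))//; last first.
  by move=> k; exact: lebesgue_outer_ge0.
pose P k (c : nat -> 'rV[R]_n.+1 * 'rV[R]_n.+1) := box_cover (A k) c /\
  \sum_(j <oo) (box_vol (c j))%:E <=
    lebesgue_outer (A k) + (e%:num / (2 ^ k.+1)%:R)%:E.
have [G PG] : {G : nat -> nat -> 'rV[R]_n.+1 * 'rV[R]_n.+1 &
    forall k, P k (G k)}.
  apply: (@choice _ _ P) => k; rewrite /P /lebesgue_outer.
  set S := (X in ereal_inf X); move infS : (ereal_inf S) => iS.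
  case: iS infS => [r Sr|Soo|Soo].
  - have en1 : (0 < e%:num / (2 ^ k.+1)%:R)%R by [].
    have /(lb_ereal_inf_adherent en1) : ereal_inf S \is a fin_num by rewrite Sr.
    move=> [x [c Ac volx] xS].
    by exists c; split => //; rewrite volx -Sr; exact/ltW.
  - by have := Aoo k; rewrite /lebesgue_outer Soo.
  - suff : lbound S 0 by move/le_ereal_inf_tmp; rewrite Soo.
    by move=> /= _ [c _ <-]; exact: nneseries_ge0.
pose w (ij : nat * nat) : \bar R := (box_vol (uncurry G ij))%:E.
have w_ge0 x : 0 <= w x by exact: vol_ge0.
apply: (@le_trans _ _ (\esum_(i in setT) w i)).
  apply: ereal_inf_lbound => /=.
  have /card_esym/ppcard_eqP[f] := card_nat2.
  exists (uncurry G \o f).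
    move=> t [i _ /((PG i).1)[j _ Bijt]].
    by exists (f^-1%FUN (i, j)) => //=; rewrite invK ?inE.
  rewrite -(esum_pred_image w _ xpredT) ?[fun=> _]set_true//.
  by rewrite image_eq.
rewrite (_ : esum _ _ = \sum_(i <oo) \sum_(j <oo) w (i, j)); last first.
  pose J : nat -> set (nat * nat) := fun i => [set (i, j) | j in setT].
  rewrite (_ : setT = \bigcup_k J k); last first.
    by rewrite predeqE => -[a b]; split => // _; exists a => //; exists b.
  rewrite esum_bigcupT //=; last first.
    apply/trivIsetP => i j _ _ ij.
    rewrite predeqE => -[k m] /=; split => //= -[] [_] _ [<-{k} _].
    by move=> [m' _] [] /esym/eqP; rewrite (negbTE ij).
  rewrite -(image_id [set: nat]) -fun_true esum_pred_image//; last first.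
    by move=> k _; exact: esum_ge0.
  apply: eq_eseriesr => /= j _.
  rewrite -(esum_pred_image w (pair j) predT)//=; last first.
    by move=> ? ? _ _; exact: (@can_inj _ _ _ snd).
  by congr esum; rewrite predeqE => -[a b]; split; move=> [i _ <-]; exists i.
apply: lee_lim.
- apply: is_cvg_nneseries => k *.
  by apply: nneseries_ge0 => m *; exact: (w_ge0 (k, m)).
- by apply: is_cvg_nneseries => k *; apply: adde_ge0 => //;
    exact: lebesgue_outer_ge0.
- by near=> k; apply: lee_sum => i _; exact: (PG i).2.
Unshelve. all: by end_near. Qed.

HB.instance Definition _ := isOuterMeasure.Build R 'rV[R]_n.+1 lebesgue_outer
  lebesgue_outer0 lebesgue_outer_ge0 le_lebesgue_outer
  lebesgue_outer_sigma_subadditive.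

End lebesgue_measure_Rn.

(* 'rV[R]_n.+1 with the sigma-algebra of Lebesgue measurable sets; it is
   convertible to 'rV[R]_n.+1. *)
Notation lebesgue_space R n := (caratheodory_type (@lebesgue_outer R n)).

Definition lebesgue_Rn (R : realType) (n : nat) :
    {measure set (lebesgue_space R n) -> \bar R} :=
  let mu : {outer_measure set 'rV[R]_n.+1 -> \bar R} := lebesgue_outer in
  (mu : set (caratheodory_type mu) -> \bar R).

Section linear_algebra.
Context {R : realType} {n : nat}.
Implicit Types (A : 'M[R]_n) (xi eta : 'cV[R]_n).

Definition dot xi eta : R := \sum_i xi i ord0 * eta i ord0.

Definition enorm xi : R := Num.sqrt (dot xi xi).

Definition op_norm A : R :=
  sup [set enorm (A *m xi) | xi in [set xi : 'cV[R]_n | enorm xi = 1]].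

Definition sym_psd A : Prop := A^T = A /\ forall xi, 0 <= dot xi (A *m xi).

(* The unique symmetric positive semidefinite square root of A, when A is
   symmetric positive semidefinite. *)
Definition sqrtmx A : 'M[R]_n := xget 0 [set B | sym_psd B /\ B *m B = A].

End linear_algebra.

Section weighted_spaces.
Context {R : realType} {n : nat}.
Local Notation E := (lebesgue_space R n).
Local Notation mu := (lebesgue_Rn R n).
Implicit Types (Omega : set 'rV[R]_n.+1) (v : 'rV[R]_n.+1 -> R) (p : R).
Implicit Types (Q : 'rV[R]_n.+1 -> 'M[R]_n.+1).
Implicit Types (f g u phi F : 'rV[R]_n.+1 -> R) (U t : 'rV[R]_n.+1 -> 'cV[R]_n.+1).

Definition meas_on Omega f : Prop :=
  measurable_fun (Omega : set E) (f : E -> R).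

Definition vmeas_on Omega U : Prop :=
  forall i, meas_on Omega (fun x => U x i ord0).

Definition mxmeas_on Omega Q : Prop :=
  forall i j, meas_on Omega (fun x => Q x i j).

Definition locally_Lp Omega p f : Prop :=
  meas_on Omega f /\
  forall K : set 'rV[R]_n.+1, compact K -> K `<=` Omega ->
    (\int[mu]_(x in K) (`|f x| `^ p)%:E < +oo)%E.

Definition Lp_norm v Omega p f : \bar R :=
  ((\int[mu]_(x in Omega) (`|f x| `^ p * v x)%:E) `^ (p^-1))%E.

Definition in_Lp v Omega p f : Prop :=
  meas_on Omega f /\ (Lp_norm v Omega p f < +oo)%E.

Definition QLp_norm Q Omega p U : \bar R :=
  ((\int[mu]_(x in Omega) (enorm (sqrtmx (Q x) *m U x) `^ p)%:E) `^ (p^-1))%E.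

Definition in_QLp Q Omega p U : Prop :=
  vmeas_on Omega U /\ (QLp_norm Q Omega p U < +oo)%E.

(* P holds almost everywhere on Omega for the measure v dx. *)
Definition weighted_ae v Omega (P : 'rV[R]_n.+1 -> Prop) : Prop :=
  exists N : set E, [/\ measurable N,
    (\int[mu]_(x in Omega `&` N) (v x)%:E = 0)%E &
    forall x, Omega x -> ~ P x -> N x].

Definition in_Linf v Omega F : Prop :=
  meas_on Omega F /\ exists M : R, weighted_ae v Omega (fun x => `|F x| <= M).

(* The classical gradient, made of the partial derivatives; for locally
   Lipschitz functions they exist almost everywhere, and 'D_ has a conventional
   value on the exceptional null set. *)
Definition grad phi (x : 'rV[R]_n.+1) : 'cV[R]_n.+1 :=
  \col_i 'D_(delta_mx ord0 i) phi x.

Definition Lip_loc Omega phi : Prop :=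
  forall K : set 'rV[R]_n.+1, compact K -> K `<=` Omega ->
    [lipschitz phi x | x in K].

Definition Lip_0 Omega phi : Prop :=
  Lip_loc Omega phi /\
  exists K : set 'rV[R]_n.+1, [/\ compact K, K `<=` Omega &
    forall x, Omega x -> ~ K x -> phi x = 0].

Definition QLip v Q Omega p phi : Prop :=
  [/\ Lip_loc Omega phi, in_Lp v Omega p phi & in_QLp Q Omega p (grad phi)].

Definition QLip_0 v Q Omega p phi : Prop :=
  Lip_0 Omega phi /\ QLip v Q Omega p phi.

(* (u, U) lies in the closure of the pairs (phi, grad phi); elements of the
   spaces are handled through representatives. *)
Definition QH_0 v Q Omega p u U : Prop :=
  [/\ in_Lp v Omega p u, in_QLp Q Omega p U &
    forall e : R, 0 < e -> exists2 phi, QLip_0 v Q Omega p phi &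
      (Lp_norm v Omega p (fun x => u x - phi x)%R +
       QLp_norm Q Omega p (fun x => U x - grad phi x)%R < e%:E)%E].

Definition Sobolev_property v Q Omega p : Prop :=
  exists2 S : R, 0 < S & forall phi, QLip_0 v Q Omega p phi ->
    (Lp_norm v Omega p phi <= S%:E * QLp_norm Q Omega p (grad phi))%E.

Definition subunit_field v Q Omega p t : Prop :=
  vmeas_on Omega t /\
  exists C : R, forall phi, QLip_0 v Q Omega p phi ->
    (Lp_norm v Omega p (fun x => dot (t x) (grad phi x))
     <= C%:E * QLp_norm Q Omega p (grad phi))%E.

Definition admissible_potential v Omega F : Prop :=
  in_Linf v Omega F /\ weighted_ae v Omega (fun x => 0 <= F x).

(* |a|^(p-2) a and |sqrt Q xi|^(p-2) Q xi vanish at a = 0, resp. when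
   sqrt Q xi = 0, since powR is real-valued and then multiplied by 0. *)
Definition weak_solution v Q Omega p F t f g u U : Prop :=
  QH_0 v Q Omega p u U /\
  forall phi, QLip_0 v Q Omega p phi ->
    \int[mu]_(x in Omega)
       (enorm (sqrtmx (Q x) *m U x) `^ (p - 2) *
        dot (Q x *m U x) (grad phi x))
    + \int[mu]_(x in Omega) (F x * (`|u x| `^ (p - 2) * u x) * phi x * v x)
    = \int[mu]_(x in Omega) (`|f x| `^ (p - 2) * f x * phi x * v x)
    + \int[mu]_(x in Omega)
       (`|g x| `^ (p - 2) * g x * dot (t x) (grad phi x) * v x).

Definition Dirichlet_property v Q Omega p : Prop :=
  (forall F t f g,
     admissible_potential v Omega F -> subunit_field v Q Omega p t ->
     in_Lp v Omega p f -> in_Lp v Omega p g ->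
     exists u U, weak_solution v Q Omega p F t f g u U) /\
  (forall F t,
     admissible_potential v Omega F -> subunit_field v Q Omega p t ->
     exists2 c0 : R, 0 < c0 & forall f g u U,
       in_Lp v Omega p f -> in_Lp v Omega p g ->
       weak_solution v Q Omega p F t f g u U ->
       (Lp_norm v Omega p u <=
        c0%:E * (Lp_norm v Omega p f + Lp_norm v Omega p g))%E).

End weighted_spaces.

(* Main.v *)
Require Import Defs.
From mathcomp Require Import all_boot all_order all_algebra.
From mathcomp Require Import all_classical all_reals all_analysis.
From mathcomp Require Import measurable_realfun complex ring lra.

Import Order.TTheory GRing.Theory Num.Theory.
Import numFieldNormedType.Exports.

Local Open Scope classical_set_scope.
Local Open Scope ring_scope.

(* Test the equation with phi close to u in QH_0. Then ||U||^p (in QL^p) is the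
   flux paired with grad phi plus the flux paired with U - grad phi. Every
   pairing is absorbed by the crude Young inequality
     x^(p-1) y <= d x^p + d^(1-p) y^p,
   integrated, so neither Hoelder nor Minkowski is needed: the Sobolev and
   subunit inequalities bound the p-th powers of the norms of phi and
   t . grad phi by that of grad phi, hence by ||U||^p up to a vanishing error.
   This leaves ||U||^p <= K (||f||^p + ||g||^p + ||u||^p), and regularity
   controls the norm of u. *)

(** * Square roots of positive semidefinite matrices *)

Lemma poly_interpolation (K : fieldType) (h : K -> K) (s : seq K) :
  exists q : {poly K}, {in s, forall x, q.[x] = h x}.
Proof.
elim: s => [|x s [q qs]]; first by exists 0.
have [xs|xNs] := boolP (x \in s).
  by exists q => y; rewrite inE => /predU1P[->|]; [exact: qs | exact: qs].
(* Newton's correction: [m] vanishes at the old nodes and not at [x], so a multiple of it repairs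
   the value at [x] alone. *)
pose m := \prod_(y <- s) ('X - y%:P).
have mx : m.[x] != 0 by rewrite -[_ == 0]/(root m x) root_prod_XsubC.
exists (q + ((h x - q.[x]) / m.[x]) *: m) => y; rewrite inE !hornerE.
case/predU1P => [->|ys]; first by rewrite divfK// addrC subrK.
have /rootP -> : root m y by rewrite root_prod_XsubC.
by rewrite mulr0 addr0 qs.
Qed.

Lemma trmx_horner_mx (K : comNzRingType) n (A : 'M[K]_n.+1) (q : {poly K}) :
  (horner_mx A q)^T = horner_mx A^T q.
Proof.
elim/poly_ind: q => [|q a IH]; first by rewrite !rmorph0 trmx0.
rewrite !rmorphD !rmorphM /= !horner_mx_X !horner_mx_C raddfD /= trmx_mul IH tr_scalar_mx.
by congr (_ + _); apply: comm_mx_horner; exact: comm_mx_refl.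
Qed.

Lemma dot_mulmxl (K : realType) n (B : 'M[K]_n) (xi eta : 'cV[K]_n) :
  dot (B *m xi) eta = dot xi (B^T *m eta).
Proof.
have dotE (x y : 'cV[K]_n) : dot x y = (x^T *m y) ord0 ord0.
  by rewrite mxE; apply: eq_bigr => i _; rewrite mxE.
by rewrite !dotE trmx_mul mulmxA.
Qed.

(** A polynomial acts on a diagonalised matrix through its eigenvalues alone. The field is general
    because the diagonalisation used below is complex. *)
Lemma horner_mx_diagonalized (K : fieldType) n (A P : 'M[K]_n.+1)
    (d : 'rV[K]_n.+1) (q : {poly K}) : P \in unitmx ->
  A = invmx P *m diag_mx d *m P -> (forall i, q.[d ord0 i] = d ord0 i) ->
  horner_mx A q = A.
Proof.
move=> Pu -> qd; rewrite horner_mx_uconjC// horner_mx_diag.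
by congr (_ *m diag_mx _ *m _); apply/rowP => i; rewrite mxE qd.
Qed.

Section sqrtmx.
Context {R : realType} {n : nat}.
Implicit Types A B : 'M[R]_n.+1.

(** The quadratic form at an eigenvector is [a] times its squared length. The transpose appears
    because [eigenvalue] refers to row vectors. *)
Lemma psd_eigenvalue_ge0 A (a : R) :
  (forall xi : 'cV[R]_n.+1, 0 <= dot xi (A *m xi)) -> eigenvalue A^T a -> 0 <= a.
Proof.
move=> A0 /eigenvalueP[w wA w0].
have := A0 w^T.
rewrite -[A]trmxK -trmx_mul wA /dot.
under eq_bigr do rewrite !mxE mulrCA -expr2.
rewrite -mulr_sumr pmulr_lge0// lt_def psumr_eq0; last by move=> *; exact: sqr_ge0.
rewrite sumr_ge0 ?andbT; last by move=> *; exact: sqr_ge0.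
apply: contra w0 => /allP w0; apply/eqP/rowP => i.
by have := w0 i (mem_index_enum _); rewrite sqrf_eq0 !mxE => /eqP.
Qed.

(** The spectral theorem is applied over the complex numbers; a real polynomial interpolating the
    fourth root on the eigenvalues is then evaluated at [A] itself, so the result is a real
    matrix. *)
Lemma sym_psd_sqrt_exists A : sym_psd A -> exists B, sym_psd B /\ B *m B = A.
Proof.
move=> [Asym A0].
pose c := real_complex R.
pose Ac := map_mx c A.
have Acreal : Ac \is a mxOver Num.real.
  by apply/mxOverP => i j; rewrite mxE; apply/complex_realP; exists (A i j).
have Acsym : Ac \is symmetricmx.
  by rewrite qualifE /= expr0 scale1r map_mx_id// map_trmx Asym.
have Acherm := realsym_hermsym Acsym Acreal.
have /orthomx_spectralP := hermitian_normalmx Acherm.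
set P := spectralmx Ac; set d := spectral_diag Ac => Aspec.
have Pu : P \in unitmx by exact: spectral_unit.
pose e i := complex.Re (d ord0 i).
have dE i : d ord0 i = c (e i).
  by rewrite /c RRe_real//; exact: (mxOverP (hermitian_spectral_diag_real Acherm)).
have e0 i : 0 <= e i.
  apply: (@psd_eigenvalue_ge0 A) => //; rewrite Asym.
  (* Being an eigenvalue passes from [Ac] to [A] through the characteristic polynomial; over [Ac],
     row [i] of [P] is an eigenvector. *)
  rewrite eigenvalue_root_char -(fmorph_root c) map_char_poly.
  rewrite -[X in root _ X]dE -eigenvalue_root_char.
  apply/eigenvalueP; exists (row i P); last first.
    apply: contraTneq Pu => Pi0.
    rewrite unitmxE (expand_det_row _ i) big1 ?unitr0// => j _.
    by have /rowP/(_ j) := Pi0; rewrite !mxE => ->; rewrite mul0r.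
  rewrite -row_mul -/Ac {1}Aspec !mulmxA mulmxV// mul1mx row_mul.
  have -> : row i (diag_mx d) = d ord0 i *: delta_mx 0 i.
    apply/rowP => j; rewrite !mxE eqxx /= [j == i]eq_sym.
    by case: (i =P j) => [ij|_]; rewrite -?ij ?mulr1n ?mulr1 ?mulr0n ?mulr0.
  by rewrite -scalemxAl -rowE.
have [q qE] := poly_interpolation _ (fun x : R => Num.sqrt (Num.sqrt x))
  [seq e i | i <- enum 'I_n.+1].
have q4 : horner_mx A (q ^+ 4) = A.
  apply: (@map_mx_inj _ _ (real_complex R)).
  rewrite map_horner_mx; apply: (horner_mx_diagonalized _ _ _ _ _ _ Pu Aspec) => i.
  rewrite dE horner_map /= horner_exp qE.
    by rewrite (exprM _ 2 2) !sqr_sqrtr ?sqrtr_ge0.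
  by apply/mapP; exists i; rewrite ?mem_enum.
(* The square root is B ^ 2, with B a symmetric fourth root: as the square of a
   symmetric matrix it is visibly positive semidefinite. *)
pose B := horner_mx A q.
have Bsym : B^T = B.
  by rewrite trmx_horner_mx Asym.
exists (B *m B); split; last by rewrite -[RHS]q4 !exprS mulr1 !rmorphM /= -mulmxA.
split; first by rewrite trmx_mul Bsym.
move=> xi; have -> : dot xi (B *m B *m xi) = dot (B *m xi) (B *m xi).
  by rewrite dot_mulmxl Bsym mulmxA.
by apply: sumr_ge0 => i _; rewrite -expr2 sqr_ge0.
Qed.

End sqrtmx.

(** * Lebesgue measurability of open sets *)

Section lebesgue_measurable_open.
Context {R : realType} {n : nat}.
Local Notation E := (lebesgue_space R n).

Definition set_coord (i : 'I_n.+1) (a : R) (x : 'rV[R]_n.+1) : 'rV[R]_n.+1 :=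
  \row_j if j == i then a else x ord0 j.

(** The hyperplane at height [a] cuts the box in two. If it misses the box, the clamps [max] and
    [min] make one piece have volume zero, so additivity holds for every [a]. *)
Lemma box_vol_split (i : 'I_n.+1) (a : R) (c : 'rV[R]_n.+1 * 'rV[R]_n.+1) :
  box_vol (set_coord i (Num.max (c.1 ord0 i) a) c.1, c.2) +
  box_vol (c.1, set_coord i (Num.min (c.2 ord0 i) a) c.2) = box_vol c.
Proof.
rewrite /box_vol !(@bigD1 _ _ _ _ i xpredT)//= !mxE eqxx.
rewrite (eq_bigr (fun j => Num.max 0 (c.2 ord0 j - c.1 ord0 j))); last first.
  by move=> j /negbTE ji; rewrite !mxE ji.
rewrite [X in _ + _ * X](eq_bigr (fun j => Num.max 0 (c.2 ord0 j - c.1 ord0 j))); last first.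
  by move=> j /negbTE ji; rewrite !mxE ji.
rewrite -mulrDl; congr (_ * _).
case: (lerP (c.1 ord0 i) a) => ?; case: (lerP (c.2 ord0 i) a) => ?;
  do ![case: lerP => ?]; lra.
Qed.

(** Caratheodory's criterion: cutting each box of a cover of [X] along the hyperplane yields covers
    of the two parts of [X] with the same total volume. *)
Lemma measurable_halfspace (i : 'I_n.+1) (a : R) :
  measurable ([set x | a < x ord0 i] : set E).
Proof.
apply: le_caratheodory_measurable => X.
rewrite [X in (_ <= X)%E]/=; apply: le_ereal_inf_tmp => _ [c Xc <-].
pose c1 k := (set_coord i (Num.max ((c k).1 ord0 i) a) (c k).1, (c k).2).
pose c2 k := ((c k).1, set_coord i (Num.min ((c k).2 ord0 i) a) (c k).2).
have c0 k : (0 <= (box_vol (c k))%:E)%E by rewrite lee_fin box_vol_ge0.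
rewrite (@eq_eseriesr _ _ (fun k => (box_vol (c1 k))%:E + (box_vol (c2 k))%:E)%E); last first.
  by move=> k _; rewrite -EFinD box_vol_split.
rewrite nneseriesD; try by move=> *; rewrite lee_fin box_vol_ge0.
apply: leeD; apply: ereal_inf_lbound.
- exists c1 => // x [/Xc[k _ xk] ax]; exists k => // j; rewrite /= mxE.
  have /andP[lo ->] := xk j; rewrite andbT; case: eqP => [->|//].
  by have /andP[+ _] := xk i; rewrite gt_max => -> /=.
- exists c2 => // x [/Xc[k _ xk] ax]; exists k => // j; rewrite /= mxE.
  have /andP[-> hi] := xk j; case: eqP => [->|//] /=.
  have /andP[_] := xk i; rewrite le_min => -> /=.
  by rewrite leNgt; exact/negP.
Qed.

Lemma measurable_box (c : 'rV[R]_n.+1 * 'rV[R]_n.+1) : measurable (box c : set E).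
Proof.
rewrite (_ : box c = \bigcap_(i in [set: 'I_n.+1])
    ([set x : E | c.1 ord0 i < x ord0 i] `\` [set x : E | c.2 ord0 i < x ord0 i])).
  apply: fin_bigcap_measurable; first exact: finite_finset.
  by move=> i _; apply: measurableD; exact: measurable_halfspace.
apply/seteqP; split => x /= xc i.
  by move=> _; have /andP[lo hi] := xc i; split => //; apply/negP; rewrite -leNgt.
by have [lo /negP] := xc i I; rewrite /= -leNgt => ->; rewrite lo.
Qed.

(** An open set is the countable union of the boxes inside it that have a rational centre and
    half-width [1 / (k + 1)]. *)
Lemma open_lebesgue_measurable (O : set 'rV[R]_n.+1) :
  open O -> measurable (O : set E).
Proof.
move=> oO.
pose r (k : nat) : R := k.+1%:R^-1.
pose B (q : 'rV[rat]_n.+1 * nat) :=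
  box (\row_i (ratr (q.1 ord0 i) - r q.2), \row_i (ratr (q.1 ord0 i) + r q.2)).
rewrite (_ : O = \bigcup_q if `[< B q `<=` O >] then B q else set0).
  apply: countable_bigcupT_measurable; first exact: countableP.
  by move=> q; case: ifPn => // _; exact: measurable_box.
apply/seteqP; split => [x Ox|x [q _]]; last by case: asboolP => // BO /BO.
have /nbhs_ballP[e /= e0 xeO] : nbhs x O by exact: open_nbhs_nbhs.
(* The centre will be chosen within [r k] of [x], so every point of the box lies within [2 * r k] of
   [x]. *)
have [k ke] : exists k, 2 * r k < e.
  have /ltr_add_invr[k] : 0 < e / 2 by rewrite divr_gt0.
  by rewrite add0r => ke; exists k; rewrite mulrC -ltr_pdivlMr.
have rk : 0 < r k by rewrite invr_gt0.
have Hq i : exists q : rat, x ord0 i - r k < ratr q < x ord0 i + r k.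
  have /rat_in_itvoo[q] : x ord0 i - r k < x ord0 i + r k by lra.
  by rewrite in_itv => qP; exists q.
have [q qP] := choice Hq.
pose qk := (\row_i q i, k).
have xB : B qk x by move=> i; rewrite /= !mxE; have := qP i; lra.
exists qk => //; case: asboolP => // -[] y yB; apply: xeO; split => // i j.
rewrite ord1 /ball /= ltr_norml.
have := yB j; have := qP j; rewrite /= !mxE; lra.
Qed.

End lebesgue_measurable_open.

(** * Young's inequality with a parameter *)

Section young.
Context {R : realType}.
Implicit Types (p e : R).

Lemma powR_mulVr p (x : R) : 1 < p -> 0 <= x -> x `^ (p - 2) * x = x `^ (p - 1).
Proof.
move=> p1 x0; have -> : p - 2 = (p - 1) - 1 by lra.
by rewrite mulrC mulr_powRB1// subr_gt0.
Qed.

(** If [y <= d * x], the first term on the right suffices; otherwise [x < y / d] and the second one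
    does. *)
Lemma young_powR p (d x y : R) : 1 < p -> 0 < d -> 0 <= x -> 0 <= y ->
  x `^ (p - 1) * y <= d * x `^ p + d `^ (1 - p) * y `^ p.
Proof.
move=> p1 d0 x0 y0; have p0 : 0 < p by lra.
have [ydx|xyd] := leP y (d * x).
  rewrite ler_wpDr ?mulr_ge0 ?powR_ge0// -(mulr_powRB1 x0 p0).
  by rewrite mulrA mulrC ler_wpM2r ?powR_ge0.
rewrite ler_wpDl ?mulr_ge0 ?powR_ge0 ?(ltW d0)// -(mulr_powRB1 y0 p0) mulrCA mulrC.
rewrite ler_wpM2l// -[1 - p]opprB powRN ler_pdivlMl ?powR_gt0//.
rewrite -powRM ?(ltW d0)//.
by rewrite ge0_ler_powR ?nnegrE ?mulr_ge0 ?(ltW d0) ?(ltW xyd)//; lra.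
Qed.

Lemma young_small_right p e : 1 < p -> 0 < e -> exists2 C : R, 0 <= C &
  forall x y : R, 0 <= x -> 0 <= y ->
    x `^ (p - 1) * y <= C * x `^ p + e * y `^ p.
Proof.
(* This is [d^(1-p)^-1] with [d := e]: used as the parameter of [young_powR], it makes the
   coefficient of [y^p] equal to [e]. *)
move=> p1 e0; exists (e `^ (1 - p)^-1); first exact: powR_ge0.
move=> x y x0 y0; have p1' : 1 - p != 0 by rewrite subr_eq0 lt_eqF.
have := @young_powR p (e `^ (1 - p)^-1) x y p1 (powR_gt0 _ e0) x0 y0.
by rewrite -powRrM mulVf// powRr1 ?(ltW e0).
Qed.

Lemma powR_addr_le p (x y : R) : 0 <= p -> 0 <= x -> 0 <= y ->
  (x + y) `^ p <= 2 `^ p * (x `^ p + y `^ p).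
Proof.
move=> p0; wlog xy : x y / x <= y => [H|] x0 y0.
  have [/H->//|/ltW/H] := leP x y.
  by rewrite addrC [y `^ _ + _]addrC; exact.
apply: (@le_trans _ _ ((2 * y) `^ p)).
  by rewrite ge0_ler_powR ?nnegrE ?addr_ge0 ?mulr_ge0//; lra.
by rewrite powRM// ler_wpM2l ?powR_ge0// ler_wpDl ?powR_ge0.
Qed.

End young.

(** * Integrating Young's inequality *)

Section integral_bounds.
Context d (T : measurableType d) (R : realType) (mu : {measure set T -> \bar R}).
Variables (D : set T) (mD : measurable D).
Implicit Types (a b w k h : T -> R).

Lemma integrable_poweR_lty (q : R) h : 0 < q -> measurable_fun D h ->
  (forall x, D x -> 0 <= h x) ->
  ((\int[mu]_(x in D) (h x)%:E) `^ q < +oo)%E ->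
  mu.-integrable D (EFin \o h).
Proof.
move=> q0 mh h0 hoo; apply/integrableP; split; first exact/measurable_EFinP.
apply: (lty_poweRy (r := q)); first by rewrite gt_eqF.
rewrite (_ : (\int[mu]_(x in D) _)%E = \int[mu]_(x in D) (h x)%:E)%E//.
by apply: eq_integral => x /[!inE] Dx /=; rewrite ger0_norm// h0.
Qed.

Lemma integral_Rintegral h : mu.-integrable D (EFin \o h) ->
  (\int[mu]_(x in D) (h x)%:E)%E = (\int[mu]_(x in D) h x)%:E.
Proof. by move=> ih; rewrite fineK//; exact: integrable_fin_num. Qed.

(** Common pattern of all pairings in the weak formulation. Young's inequality is a hypothesis so
    that either term may carry the small constant; [w] will be [v] or 1; the domination is only
    almost everywhere, as bounds on the potential are. *)
Lemma young_Rintegral (p M C e : R) (w a b k : T -> R) :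
  0 <= M -> 0 <= C -> 0 <= e ->
  (forall x y : R, 0 <= x -> 0 <= y ->
    x `^ (p - 1) * y <= C * x `^ p + e * y `^ p) ->
  (forall x, D x -> [/\ 0 <= a x, 0 <= b x & 0 <= w x]) ->
  mu.-integrable D (EFin \o (fun x => a x `^ p * w x)) ->
  mu.-integrable D (EFin \o (fun x => b x `^ p * w x)) ->
  measurable_fun D k ->
  {ae mu, forall x, D x -> `|k x| <= M * (a x `^ (p - 1) * b x * w x)} ->
  mu.-integrable D (EFin \o k) /\
  `|\int[mu]_(x in D) k x| <=
    M * (C * \int[mu]_(x in D) (a x `^ p * w x) +
         e * \int[mu]_(x in D) (b x `^ p * w x)).
Proof.
move=> M0 C0 e0 young abw0 ia ib mk kle.
pose g x := M * (C * (a x `^ p * w x) + e * (b x `^ p * w x)).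
have iZ (r : R) h : mu.-integrable D (EFin \o h) ->
    mu.-integrable D (EFin \o (fun x => r * h x)).
  by move=> ih; exact: (integrableZl mD r ih).
have iCa := iZ C _ ia; have ieb := iZ e _ ib.
have iCe : mu.-integrable D (EFin \o (fun x =>
    C * (a x `^ p * w x) + e * (b x `^ p * w x))).
  by exact: (integrableD mD iCa ieb).
have ig : mu.-integrable D (EFin \o g) := iZ M _ iCe.
have g0 x : D x -> 0 <= g x.
  by move=> /abw0[? ? ?]; rewrite /g mulr_ge0 ?addr_ge0 ?mulr_ge0 ?powR_ge0.
have kg : (\int[mu]_(x in D) `|(k x)%:E| <= \int[mu]_(x in D) (g x)%:E)%E.
  apply: ae_ge0_le_integral => //.
  - by apply: measurableT_comp => //; exact/measurable_EFinP.
  - exact: measurable_int ig.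
  - apply: filterS kle => x kx Dx; rewrite lee_fin (le_trans (kx Dx))//.
    rewrite /g ler_wpM2l// !mulrA -mulrDl; have [? ? ?] := abw0 _ Dx.
    by rewrite ler_wpM2r// young.
have goo := integral_Rintegral _ ig.
have ik : mu.-integrable D (EFin \o k).
  apply/integrableP; split; first exact/measurable_EFinP.
  by rewrite (le_lt_trans kg)// goo ltry.
split => //; apply: (@le_trans _ _ (\int[mu]_(x in D) g x)).
  rewrite (le_trans (le_normr_Rintegral mD ik))// -lee_fin -goo.
  by rewrite -integral_Rintegral//; exact: (integrable_abse ik).
by rewrite /g RintegralZl// RintegralD// !RintegralZl.
Qed.

End integral_bounds.

(** * Euclidean geometry and the flux *)

Section euclidean.
Context {R : realType} {n : nat}.
Implicit Types (A : 'M[R]_n.+1) (xi eta zeta : 'cV[R]_n.+1).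

Lemma enorm_ge0 xi : 0 <= enorm xi.
Proof. exact: sqrtr_ge0. Qed.

Lemma dot_ge0 xi : 0 <= dot xi xi.
Proof. by apply: sumr_ge0 => i _; rewrite -expr2 sqr_ge0. Qed.

Lemma sqr_enorm xi : enorm xi ^+ 2 = dot xi xi.
Proof. by rewrite sqr_sqrtr// dot_ge0. Qed.

Lemma enorm_eq0 xi : enorm xi = 0 -> xi = 0.
Proof.
move=> x0; have : dot xi xi == 0 by rewrite -sqr_enorm x0 expr0n.
rewrite psumr_eq0; last by move=> i _; rewrite -expr2 sqr_ge0.
move=> /allP xi0; apply/colP => i.
by have := xi0 i (mem_index_enum _); rewrite -expr2 sqrf_eq0 mxE => /eqP.
Qed.

Lemma dot_lincomb (s t : R) xi eta :
  dot (s *: xi + t *: eta) (s *: xi + t *: eta) =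
  s ^+ 2 * dot xi xi + 2 * (s * t) * dot xi eta + t ^+ 2 * dot eta eta.
Proof.
rewrite /dot !mulr_sumr -!big_split/=; apply: eq_bigr => i _.
rewrite !mxE; ring.
Qed.

Lemma dotDr xi eta zeta : dot xi (eta + zeta) = dot xi eta + dot xi zeta.
Proof. by rewrite /dot -big_split/=; apply: eq_bigr => i _; rewrite mxE mulrDr. Qed.

Lemma ler_norm_dot xi eta : `|dot xi eta| <= enorm xi * enorm eta.
Proof.
have [/enorm_eq0 ->|x0] := eqVneq (enorm xi) 0.
  rewrite /dot big1 ?normr0 ?mulr_ge0 ?enorm_ge0// => i _.
  by rewrite mxE mul0r.
have [/enorm_eq0 ->|y0] := eqVneq (enorm eta) 0.
  rewrite /dot big1 ?normr0 ?mulr_ge0 ?enorm_ge0// => i _.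
  by rewrite mxE mulr0.
(* Expanding the squared lengths of [|eta| xi + |xi| eta] and [|eta| xi - |xi| eta] gives the two
   signs of Cauchy-Schwarz, up to the positive factor [|eta| |xi|]. *)
have := dot_ge0 (enorm eta *: xi + enorm xi *: eta).
have := dot_ge0 (enorm eta *: xi + (- enorm xi) *: eta).
rewrite !dot_lincomb -!sqr_enorm.
have xy : 0 < enorm eta * enorm xi by rewrite mulr_gt0 ?lt_def ?x0 ?y0 ?enorm_ge0.
by move=> H1 H2; rewrite ler_norml; apply/andP; split; rewrite -(ler_pM2l xy); lra.
Qed.

Lemma enormB_le xi eta : enorm (xi - eta) <= enorm xi + enorm eta.
Proof.
rewrite -(@ler_pXn2r _ 2) ?nnegrE ?addr_ge0 ?enorm_ge0// sqr_enorm.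
have -> : xi - eta = 1 *: xi + (-1) *: eta by rewrite scale1r scaleN1r.
rewrite dot_lincomb -!sqr_enorm.
have := ler_norm_dot xi eta; rewrite ler_norml => /andP[+ _].
nra.
Qed.

Lemma sqrtmxP A : sym_psd A -> sym_psd (sqrtmx A) /\ sqrtmx A *m sqrtmx A = A.
Proof. by move=> /sym_psd_sqrt_exists; exact: xgetPex. Qed.

Lemma dot_sqrtmx A xi eta : sym_psd A ->
  dot (A *m xi) eta = dot (sqrtmx A *m xi) (sqrtmx A *m eta).
Proof.
move=> /sqrtmxP[[Bsym _] BB].
by rewrite -{1}BB -mulmxA dot_mulmxl Bsym.
Qed.

Lemma flux_self A xi (p : R) : 1 < p -> sym_psd A ->
  enorm (sqrtmx A *m xi) `^ (p - 2) * dot (A *m xi) xi = enorm (sqrtmx A *m xi) `^ p.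
Proof.
move=> p1 Apsd; rewrite dot_sqrtmx// -sqr_enorm expr2 mulrA powR_mulVr ?enorm_ge0//.
by rewrite mulrC mulr_powRB1 ?enorm_ge0//; lra.
Qed.

(** Cauchy-Schwarz for the form defined by [A], seen through its square root. *)
Lemma flux_le A xi eta (p : R) : 1 < p -> sym_psd A ->
  `|enorm (sqrtmx A *m xi) `^ (p - 2) * dot (A *m xi) eta| <=
  enorm (sqrtmx A *m xi) `^ (p - 1) * enorm (sqrtmx A *m eta).
Proof.
move=> p1 Apsd; rewrite dot_sqrtmx// normrM ger0_norm ?powR_ge0//.
rewrite -powR_mulVr ?enorm_ge0// -mulrA ler_wpM2l ?powR_ge0//.
exact: ler_norm_dot.
Qed.

End euclidean.

Lemma normr_powR_mul {R : realType} (p x : R) :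
  1 < p -> `| `|x| `^ (p - 2) * x| = `|x| `^ (p - 1).
Proof. by move=> p1; rewrite normrM ger0_norm ?powR_ge0// powR_mulVr. Qed.

(** * Measurability, energies and null sets in the weighted spaces *)

Section spaces.
Context {R : realType} {n : nat}.
Local Notation E := (lebesgue_space R n).
Local Notation mu := (lebesgue_Rn R n).
Variables (Omega : set 'rV[R]_n.+1) (p : R) (v : 'rV[R]_n.+1 -> R).
Variables (Q : 'rV[R]_n.+1 -> 'M[R]_n.+1).
Hypotheses (mO : measurable (Omega : set E)) (p1 : 1 < p).
Hypotheses (mv : meas_on Omega v) (v0 : forall x, Omega x -> 0 <= v x).
Hypotheses (mQ : mxmeas_on Omega Q) (Qpsd : forall x, Omega x -> sym_psd (Q x)).
Implicit Types (f u : 'rV[R]_n.+1 -> R) (U V : 'rV[R]_n.+1 -> 'cV[R]_n.+1).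

Lemma meas_on_dot U V : vmeas_on Omega U -> vmeas_on Omega V ->
  meas_on Omega (fun x => dot (U x) (V x)).
Proof.
move=> mU mV; apply: measurable_sum => i.
by apply: measurable_funM; [exact: mU|exact: mV].
Qed.

Lemma vmeas_onM U : vmeas_on Omega U -> vmeas_on Omega (fun x => Q x *m U x).
Proof.
move=> mU i; rewrite /meas_on; under eq_fun do rewrite mxE.
by apply: measurable_sum => j; apply: measurable_funM; [exact: mQ|exact: mU].
Qed.

Lemma vmeas_onB U V : vmeas_on Omega U -> vmeas_on Omega V ->
  vmeas_on Omega (fun x => U x - V x).
Proof.
move=> mU mV i; rewrite /meas_on; under eq_fun do rewrite !mxE.
by apply: measurable_funB; [exact: mU|exact: mV].
Qed.

Lemma meas_on_powR f (r : R) : meas_on Omega f -> meas_on Omega (fun x => f x `^ r).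
Proof. by move=> mf; exact: (measurableT_comp (measurable_powR r) mf). Qed.

Lemma meas_on_norm f : meas_on Omega f -> meas_on Omega (fun x => `|f x|).
Proof. by move=> mf; apply: measurableT_comp mf; exact: normr_measurable. Qed.

Lemma meas_on_enorm U : vmeas_on Omega U ->
  meas_on Omega (fun x => enorm (sqrtmx (Q x) *m U x)).
Proof.
move=> mU.
(* [sqrtmx] is chosen by [xget]; measurability goes through |sqrt Q U|^2 = QU . U. *)
rewrite /meas_on.
apply: (eq_measurable_fun (fun x : E => dot (Q x *m U x) (U x) `^ 2^-1)).
  move=> x /[!inE] Ox; rewrite dot_sqrtmx ?powR12_sqrt ?dot_ge0//; exact: Qpsd.
by apply: meas_on_powR; apply: meas_on_dot => //; exact: vmeas_onM.
Qed.

Lemma meas_on_flux U V : vmeas_on Omega U -> vmeas_on Omega V ->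
  meas_on Omega (fun x => enorm (sqrtmx (Q x) *m U x) `^ (p - 2) * dot (Q x *m U x) (V x)).
Proof.
move=> mU mV; apply: measurable_funM; first exact/meas_on_powR/meas_on_enorm.
by apply: meas_on_dot => //; exact: vmeas_onM.
Qed.

Lemma p_gt0 : 0 < p. Proof. exact: lt_trans p1. Qed.

Lemma pV_gt0 : 0 < p^-1. Proof. by rewrite invr_gt0 p_gt0. Qed.

Lemma in_Lp_integrable f : in_Lp v Omega p f ->
  mu.-integrable Omega (EFin \o (fun x => `|f x| `^ p * v x)).
Proof.
move=> [mf foo]; refine (integrable_poweR_lty _ _ _ mu _ _ _ pV_gt0 _ _ foo).
  exact: (measurable_funM (meas_on_powR _ _ (meas_on_norm _ mf)) mv).
by move=> x Ox; apply: mulr_ge0; [exact: powR_ge0|exact: v0].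
Qed.

Lemma in_QLp_integrable U : in_QLp Q Omega p U ->
  mu.-integrable Omega (EFin \o (fun x => enorm (sqrtmx (Q x) *m U x) `^ p)).
Proof.
move=> [mU Uoo]; refine (integrable_poweR_lty _ _ _ mu _ _ _ pV_gt0 _ _ Uoo).
  exact/meas_on_powR/meas_on_enorm.
by move=> x Ox; exact: powR_ge0.
Qed.

(** Real-valued p-th powers of the norms: the estimates run on these, away from roots and extended
    reals. *)
Definition Lp_energy f := \int[mu]_(x in Omega) (`|f x| `^ p * v x).
Definition QLp_energy U := \int[mu]_(x in Omega) (enorm (sqrtmx (Q x) *m U x) `^ p).

Lemma Lp_energy_ge0 f : 0 <= Lp_energy f.
Proof. by apply: Rintegral_ge0 => x Ox; rewrite mulr_ge0 ?powR_ge0 ?v0. Qed.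

Lemma QLp_energy_ge0 U : 0 <= QLp_energy U.
Proof. by apply: Rintegral_ge0 => x Ox; rewrite powR_ge0. Qed.

Lemma Lp_normE f : in_Lp v Omega p f ->
  Lp_norm v Omega p f = (Lp_energy f `^ p^-1)%:E.
Proof. by move=> /in_Lp_integrable fi; rewrite /Lp_norm integral_Rintegral. Qed.

Lemma QLp_normE U : in_QLp Q Omega p U ->
  QLp_norm Q Omega p U = (QLp_energy U `^ p^-1)%:E.
Proof. by move=> /in_QLp_integrable Ui; rewrite /QLp_norm integral_Rintegral. Qed.

Lemma powR_root (x : R) : 0 <= x -> (x `^ p^-1) `^ p = x.
Proof. by move=> x0; rewrite -powRrM mulVf ?powRr1// gt_eqF// p_gt0. Qed.

Lemma root_le_powR (x y : R) : 0 <= x -> 0 <= y -> x `^ p^-1 <= y -> x <= y `^ p.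
Proof.
move=> x0 y0 xy; rewrite -{1}(powR_root x)// ge0_ler_powR ?nnegrE ?powR_ge0//.
exact/ltW/p_gt0.
Qed.

(** On a set that is null for [v dx], the non-negative function [v] vanishes Lebesgue-almost
    everywhere. *)
Lemma weighted_ae_ae (P : 'rV[R]_n.+1 -> Prop) : weighted_ae v Omega P ->
  {ae mu, forall x, Omega x -> v x != 0 -> P x}.
Proof.
move=> [N [mN vN0 PN]].
have mON : measurable (Omega `&` N : set E) by exact: measurableI.
have : ae_eq mu (Omega `&` N : set E) (EFin \o v) (cst 0%E).
  apply/ae_eq_integral_abs => //.
    by apply/measurable_EFinP; apply: measurable_funS mv => //; exact: subIsetl.
  rewrite -[RHS]vN0; apply: eq_integral => x /[!inE] -[Ox _] /=.
  by rewrite ger0_norm// v0.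
apply: filterS => x vx0 Ox; apply: contraNP => /(PN _ Ox) Nx.
by have /= [->] := vx0 (conj Ox Nx).
Qed.

End spaces.

(* [X], [W], [Y] stand for the p-th powers of the norms of U, U - grad phi and
   grad phi, [P] and [T] for those of phi and t . grad phi; [Iphi], [IF], [If],
   [Ig] are the four integrals of the weak formulation. *)
Lemma absorption {R : realFieldType}
    {X Y W r C C1 eta q m s c IF If Ig IW Iphi P T ef eg eu : R} :
  0 <= m -> 0 <= C -> 0 <= eta -> 0 <= (1 + m) * s + c -> 0 <= Y ->
  0 <= ef -> 0 <= eg -> 0 <= eu ->
  P <= s * Y -> T <= c * Y -> Y <= q * (X + W) ->
  eta * (q * ((1 + m) * s + c + 1)) = 4^-1 ->
  X = Iphi + IW -> Iphi + IF = If + Ig ->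
  If <= C * ef + eta * P -> Ig <= C * eg + eta * T ->
  - (m * (C * eu + eta * P)) <= IF -> IW <= 4^-1 * X + C1 * W ->
  2 * (C1 + 4^-1) * W <= r ->
  X <= 2 * (C * (1 + m)) * (ef + eg + eu) + r.
Proof.
move=> m0 C0 eta0 L0 Y0 ef0 eg0 eu0 PY TY YX etaE XE weakE If_le Ig_le IF_ge IW_le Wr.
set L := (1 + m) * s + c in L0 etaE.
(* All terms carrying [eta] together cost a quarter of [X + W]. With the quarter of [X] from [IW],
   half of [X] is absorbed, whence the factor 2 in the conclusion. *)
have small : eta * (P + T + m * P) <= 4^-1 * (X + W).
  have -> : 4^-1 * (X + W) = eta * ((L + 1) * (q * (X + W))).
    rewrite -etaE; ring.
  rewrite ler_wpM2l//; apply: (@le_trans _ _ ((L + 1) * Y)).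
    have := ler_wpM2l m0 PY; rewrite /L; lra.
  by apply: ler_wpM2l => //; apply: addr_ge0.
have CA : C * (ef + eg + m * eu) <= C * (1 + m) * (ef + eg + eu).
  rewrite -mulrA ler_wpM2l//.
  have := mulr_ge0 m0 ef0; have := mulr_ge0 m0 eg0; lra.
lra.
Qed.

(** * The energy estimate for weak solutions *)

Section caccioppoli.
Context {R : realType} {n : nat}.
Local Notation E := (lebesgue_space R n).
Local Notation mu := (lebesgue_Rn R n).
Variables (Omega : set 'rV[R]_n.+1) (p : R) (v : 'rV[R]_n.+1 -> R).
Variables (Q : 'rV[R]_n.+1 -> 'M[R]_n.+1).
Hypotheses (mO : measurable (Omega : set E)) (p1 : 1 < p).
Hypotheses (mv : meas_on Omega v) (v0 : forall x, Omega x -> 0 <= v x).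
Hypotheses (mQ : mxmeas_on Omega Q) (Qpsd : forall x, Omega x -> sym_psd (Q x)).
Implicit Types (f g u F phi : 'rV[R]_n.+1 -> R) (U V t : 'rV[R]_n.+1 -> 'cV[R]_n.+1).

Local Notation LE := (Lp_energy Omega p v).
Local Notation QE := (QLp_energy Omega p Q).

(** Serves three terms: [h] is the potential or the constant 1, and [psi] is [phi] or
    [t . grad phi]. *)
Lemma lower_order_term (M C e : R) (h f psi : 'rV[R]_n.+1 -> R) :
  0 <= C -> 0 <= e ->
  (forall x y : R, 0 <= x -> 0 <= y ->
    x `^ (p - 1) * y <= C * x `^ p + e * y `^ p) ->
  in_Lp v Omega p f -> in_Lp v Omega p psi -> meas_on Omega h ->
  weighted_ae v Omega (fun x => `|h x| <= M) ->
  `|\int[mu]_(x in Omega) (h x * (`|f x| `^ (p - 2) * f x) * psi x * v x)| <=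
    `|M| * (C * LE f + e * LE psi).
Proof.
move=> C0 e0 young fL psiL mh hM.
apply: (young_Rintegral _ _ _ mu _ mO p `|M| C e v (fun x : E => `|f x|)
  (fun x : E => `|psi x|)
  (fun x : E => h x * (`|f x| `^ (p - 2) * f x) * psi x * v x)
  (normr_ge0 M) C0 e0 young _ (in_Lp_integrable _ _ _ p1 mv v0 _ fL)
  (in_Lp_integrable _ _ _ p1 mv v0 _ psiL) _ _).2.
- by move=> x Ox; split; rewrite ?v0.
- have [[mf _] [mpsi _]] := (fL, psiL).
  apply: measurable_funM; last exact: mv.
  apply: measurable_funM; last exact: mpsi.
  apply: measurable_funM; first exact: mh.
  by apply: measurable_funM; [exact/meas_on_powR/meas_on_norm|exact: mf].
- have hM' := weighted_ae_ae Omega v mO mv v0 _ hM.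
  apply: (@filterS E _ (ae_filter_ringOfSetsType mu) _ _ _ hM') => x hx Ox.
  (* Where [v] vanishes so does the integrand, so the bound on [h] matters only where [v] is
     nonzero. *)
  have [->|vx0] := eqVneq (v x) 0; first by rewrite !mulr0 normr0.
  rewrite !normrM -normrM normr_powR_mul// (ger0_norm (v0 _ Ox)).
  rewrite -!mulrA ler_wpM2r ?mulr_ge0 ?powR_ge0 ?v0//.
  by rewrite (le_trans (hx Ox vx0))// ler_norm.
Qed.

(** Here the small constant goes on [U], to be absorbed; the large one goes on [V], which will be
    the approximation error. *)
Lemma flux_remainder (d : R) U V : 0 < d ->
  in_QLp Q Omega p U -> in_QLp Q Omega p V ->
  mu.-integrable Omega (EFin \o (fun x =>
    enorm (sqrtmx (Q x) *m U x) `^ (p - 2) * dot (Q x *m U x) (V x))) /\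
  `|\int[mu]_(x in Omega)
      (enorm (sqrtmx (Q x) *m U x) `^ (p - 2) * dot (Q x *m U x) (V x))| <=
    d * QE U + d `^ (1 - p) * QE V.
Proof.
move=> d0 UL VL.
have w1 (W : 'rV[R]_n.+1 -> 'cV[R]_n.+1) :
    (fun x => enorm (sqrtmx (Q x) *m W x) `^ p) =
    (fun x => enorm (sqrtmx (Q x) *m W x) `^ p * cst 1 x).
  by apply/funext => x; rewrite mulr1.
have iw1 W : in_QLp Q Omega p W -> mu.-integrable Omega
    (EFin \o (fun x => enorm (sqrtmx (Q x) *m W x) `^ p * cst 1 x)).
  by move=> WL; rewrite -w1; exact: in_QLp_integrable.
rewrite /QLp_energy (w1 U) (w1 V) -[X in _ <= X]mul1r.
refine (young_Rintegral _ _ _ mu _ mO p 1 d (d `^ (1 - p)) (cst 1) _ _ _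
  ler01 (ltW d0) (powR_ge0 _ _) _ _ (iw1 U UL) (iw1 V VL) _ _).
- by move=> x y; exact: young_powR.
- by move=> x Ox; split; [exact: enorm_ge0|exact: enorm_ge0|exact: ler01].
- exact: (meas_on_flux _ _ _ mQ Qpsd _ _ UL.1 VL.1).
- by apply/aeW => x Ox; rewrite mul1r mulr1 flux_le//; exact: Qpsd.
Qed.

Lemma QLp_energyB_le U V : in_QLp Q Omega p U -> in_QLp Q Omega p V ->
  in_QLp Q Omega p (fun x => U x - V x) ->
  QE V <= 2 `^ p * (QE U + QE (fun x => U x - V x)).
Proof.
move=> UL VL WL.
have iU := in_QLp_integrable Omega p Q p1 mQ Qpsd _ UL.
have iV := in_QLp_integrable Omega p Q p1 mQ Qpsd _ VL.
have iW := in_QLp_integrable Omega p Q p1 mQ Qpsd _ WL.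
rewrite /QLp_energy -(RintegralD mO iU iW).
rewrite -(RintegralZl _ mO (integrableD mO iU iW)).
apply: (le_Rintegral mO iV (integrableZl mO (2 `^ p) (integrableD mO iU iW))).
move=> x Ox; have {1}-> : V x = U x - (U x - V x) by rewrite opprB addrC subrK.
have p0 : 0 <= p by exact/ltW/p_gt0.
rewrite mulmxBr; apply: le_trans (powR_addr_le _ _ _ p0 (enorm_ge0 _) (enorm_ge0 _)).
by rewrite ge0_ler_powR ?nnegrE ?addr_ge0 ?enorm_ge0 ?enormB_le.
Qed.

(** [eta], then [C], then [K] are fixed before the data and the solution; only the approximation
    [phi] depends on them, through an error [r] that is arbitrary. *)
Lemma weak_solution_energy_le F t (S : R) :
  (forall phi, QLip_0 v Q Omega p phi ->
    (Lp_norm v Omega p phi <= S%:E * QLp_norm Q Omega p (grad phi))%E) ->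
  admissible_potential v Omega F -> subunit_field v Q Omega p t ->
  exists2 K : R, 0 <= K & forall f g u U,
    in_Lp v Omega p f -> in_Lp v Omega p g ->
    weak_solution v Q Omega p F t f g u U ->
    QE U <= K * (LE f + LE g + LE u).
Proof.
move=> Sob [[mF [M FM]] _] [mt [Ct tC]].
(* [L] times the energy of [grad phi] will bound the energies multiplied by [eta]: that of [phi]
   from [f] and, with factor [|M|], from [F], and that of [t . grad phi] from [g]. *)
pose L := (1 + `|M|) * `|S| `^ p + `|Ct| `^ p.
have L0 : 0 <= L by rewrite addr_ge0 ?mulr_ge0 ?addr_ge0 ?powR_ge0.
have two0 : 0 < 2 `^ p by apply: powR_gt0.
pose eta := 4^-1 / (2 `^ p * (L + 1)).
have eta0 : 0 < eta by rewrite divr_gt0 ?mulr_gt0 ?ltr_wpDl.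
have [C C0 young] := young_small_right p eta p1 eta0.
exists (2 * (C * (1 + `|M|))); first by rewrite !mulr_ge0 ?addr_ge0.
move=> f g u U fL gL [[uL UL approx] weak].
set A := LE f + LE g + LE u.
have [LEf LEg LEu] : [/\ 0 <= LE f, 0 <= LE g & 0 <= LE u].
  by split; exact: Lp_energy_ge0.
pose d : R := 4^-1.
pose C1 := d `^ (1 - p).
have C10 : 0 <= C1 by exact: powR_ge0.
apply/ler_addgt0Pr => r r0.
(* Chosen so that the error left after absorption, [2 * (C1 + d) * e], equals [r]; the norm
   tolerance is the p-th root of [e]. *)
pose e := r / (2 * (C1 + d)).
have e0 : 0 < e by rewrite divr_gt0 ?mulr_gt0 ?ltr_wpDl// /d invr_gt0.
have [phi phiL phi_close] := approx _ (powR_gt0 p^-1 e0).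
have [_ [_ phiLp dphiLp]] := phiL.
have W_small := le_lt_trans (leeDr _ (poweR_ge0 _ _)) phi_close.
set W := (fun x => U x - grad phi x) in W_small.
have WL : in_QLp Q Omega p W.
  split; last by rewrite (lt_trans W_small)// ltry.
  by have [[mU _] [mphi _]] := (UL, dphiLp); exact: vmeas_onB.
have We : QE W <= e.
  rewrite -(@powR_root _ p p1 e (ltW e0)); apply: root_le_powR => //.
  + exact: QLp_energy_ge0.
  + exact: powR_ge0.
  + by rewrite -lee_fin -QLp_normE// ltW.
set Y := QE (grad phi).
have Y0 : 0 <= Y by exact: QLp_energy_ge0.
have p0 : 0 <= p by exact/ltW/p_gt0.
(* Turns the Sobolev and subunit inequalities into energy form; the absolute value is there because
   [k] has no prescribed sign. *)
have energy_le (k I : R) : 0 <= I ->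
    ((I `^ p^-1)%:E <= k%:E * QLp_norm Q Omega p (grad phi))%E ->
    I <= `|k| `^ p * Y.
  move=> I0; rewrite QLp_normE// -EFinM lee_fin => Ik.
  rewrite -[Y](@powR_root _ p p1)// -powRM ?powR_ge0//.
  apply: root_le_powR => //; first by rewrite mulr_ge0 ?powR_ge0.
  by rewrite (le_trans Ik)// ler_wpM2r ?powR_ge0// ler_norm.
have phiY : LE phi <= `|S| `^ p * Y.
  apply: energy_le; first exact: Lp_energy_ge0.
  by rewrite -Lp_normE//; exact: Sob.
pose tphi x := dot (t x) (grad phi x).
have tphiL : in_Lp v Omega p tphi.
  split; first by have [mphi _] := dphiLp; exact: meas_on_dot.
  by rewrite (le_lt_trans (tC _ phiL))// QLp_normE// -EFinM ltry.
have tphiY : LE tphi <= `|Ct| `^ p * Y.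
  apply: energy_le; first exact: Lp_energy_ge0.
  by rewrite -Lp_normE//; exact: tC.
have cst1 : weighted_ae v Omega (fun=> `|1 : R| <= 1).
  exists set0; split => //; first by rewrite setI0 integral_set0.
  by move=> x _; rewrite normr1.
have boundf := lower_order_term 1 C eta (cst 1) f phi C0 (ltW eta0) young fL phiLp _ cst1.
have boundg := lower_order_term 1 C eta (cst 1) g tphi C0 (ltW eta0) young gL tphiL _ cst1.
have boundu := lower_order_term M C eta F u phi C0 (ltW eta0) young uL phiLp mF FM.
have d0 : 0 < d by rewrite invr_gt0.
have [iW boundW] := flux_remainder d U W d0 UL WL.
have [iphi _] := flux_remainder d U (grad phi) d0 UL dphiLp.
(* Since [U = grad phi + W], the energy is the flux term of the equation tested with [phi] plus a
   remainder. *)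
have XE : QE U = \int[mu]_(x in Omega)
      (enorm (sqrtmx (Q x) *m U x) `^ (p - 2) * dot (Q x *m U x) (grad phi x)) +
    \int[mu]_(x in Omega)
      (enorm (sqrtmx (Q x) *m U x) `^ (p - 2) * dot (Q x *m U x) (W x)).
  rewrite -RintegralD//; apply: eq_Rintegral => x /[!inE] Ox /=.
  have UW : dot (Q x *m U x) (U x) =
      dot (Q x *m U x) (grad phi x) + dot (Q x *m U x) (W x).
    by rewrite -dotDr /W addrC subrK.
  by rewrite -(flux_self _ _ _ p1 (Qpsd x Ox)) UW; exact: mulrDr.
have Yle : Y <= 2 `^ p * (QE U + QE W) by exact: QLp_energyB_le.
have cst1E (h psi : 'rV[R]_n.+1 -> R) :
    \int[mu]_(x in Omega) (cst 1 x * (`|h x| `^ (p - 2) * h x) * psi x * v x) =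
    \int[mu]_(x in Omega) (`|h x| `^ (p - 2) * h x * psi x * v x).
  by apply: eq_Rintegral => x _; rewrite mul1r.
have mcst : meas_on Omega (cst 1) by exact: measurable_cst.
move: {boundf boundg} (boundf mcst) (boundg mcst) boundu boundW XE (weak phi phiL).
rewrite !cst1E normr1 !mul1r -/tphi -/C1 !ler_norml.
set X := QE U; set IF := \int[mu]_(x in Omega) (F x * _ * _ * _).
set If := \int[mu]_(x in Omega) (`|f x| `^ _ * _ * _ * _).
set Ig := \int[mu]_(x in Omega) (`|g x| `^ _ * _ * _ * _).
set IW := Rintegral _ _ _; set Iphi := Rintegral _ _ _.
move=> /andP[_ If_le] /andP[_ Ig_le] /andP[IF_ge _] /andP[_ IW_le] XE weakE.
have etaE : eta * (2 `^ p * (L + 1)) = 4^-1.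
  by rewrite divfK// mulf_neq0 ?gt_eqF ?ltr_wpDl.
have We' : 2 * (C1 + d) * QE W <= r.
  rewrite -(_ : 2 * (C1 + d) * e = r).
    by rewrite ler_wpM2l ?mulr_ge0 ?addr_ge0 ?(ltW d0).
  by rewrite mulrC divfK// mulf_neq0 ?gt_eqF ?ltr_wpDl.
exact: (absorption (normr_ge0 M) C0 (ltW eta0) L0 Y0 LEf LEg LEu phiY tphiY Yle etaE
  XE weakE If_le Ig_le IF_ge IW_le We').
Qed.

End caccioppoli.

(** * From energies back to norms *)

Lemma root_energy_le {R : realType} (p K c0 : R) {X ef eg eu : R} :
  1 < p -> 0 <= K -> 0 <= c0 ->
  0 <= X -> 0 <= ef -> 0 <= eg -> 0 <= eu -> X <= K * (ef + eg + eu) ->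
  eu `^ p^-1 <= c0 * (ef `^ p^-1 + eg `^ p^-1) ->
  X `^ p^-1 <= (K * (2 + c0 `^ p)) `^ p^-1 * (ef `^ p^-1 + eg `^ p^-1).
Proof.
move=> p1 K0 c00 X0 ef0 eg0 eu0 X_le u_le.
set N := ef `^ p^-1 + eg `^ p^-1 in u_le *.
have N0 : 0 <= N by rewrite addr_ge0 ?powR_ge0.
(* Each energy is compared with [N^p]: those of [f] and [g] cost 1 each and that of [u] costs
   [c0^p], which gives [2 + c0^p]. *)
have f_le : ef <= N `^ p by apply: root_le_powR; rewrite // lerDl powR_ge0.
have g_le : eg <= N `^ p by apply: root_le_powR; rewrite // lerDr powR_ge0.
have {}u_le : eu <= c0 `^ p * N `^ p.
  by rewrite -powRM//; apply: root_le_powR; rewrite ?mulr_ge0.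
have {}X_le : X <= K * (2 + c0 `^ p) * N `^ p.
  rewrite (le_trans X_le)// -mulrA ler_wpM2l//.
  by move: f_le g_le u_le; rewrite mulrDl; lra.
have k0 : 0 <= K * (2 + c0 `^ p) by rewrite mulr_ge0 ?addr_ge0 ?powR_ge0.
apply: (@le_trans _ _ ((K * (2 + c0 `^ p) * N `^ p) `^ p^-1)).
  apply: ge0_ler_powR X_le; rewrite ?nnegrE//; first exact/ltW/pV_gt0.
  by rewrite mulr_ge0 ?powR_ge0.
rewrite (powRM p^-1 k0 (powR_ge0 N p)) -(powRrM N p p^-1).
by rewrite (mulfV (lt0r_neq0 (p_gt0 p p1))) (powRr1 N0).
Qed.

Theorem corollary1p6 (R : realType) (n : nat)
  (Omega : set 'rV[R]_n.+1) (p : R)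
  (v : 'rV[R]_n.+1 -> R) (Q : 'rV[R]_n.+1 -> 'M[R]_n.+1)
  (Omega_bounded : bounded_set Omega)
  (Omega_connected : connected Omega)
  (Omega_open : open Omega)
  (p_gt1 : 1 < p)
  (v_meas : meas_on Omega v)
  (v_ge0 : forall x, Omega x -> 0 <= v x)
  (Q_meas : mxmeas_on Omega Q)
  (Q_psd : forall x, Omega x -> sym_psd (Q x))
  (Q_loc : locally_Lp Omega (p / 2) (fun x => op_norm (Q x)))
  (vQ_sobolev : Sobolev_property v Q Omega p)
  (vQ_dirichlet : Dirichlet_property v Q Omega p)
  (F : 'rV[R]_n.+1 -> R) (t : 'rV[R]_n.+1 -> 'cV[R]_n.+1)
  (F_adm : admissible_potential v Omega F)
  (t_subunit : subunit_field v Q Omega p t) :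
  exists2 c1 : R, 0 < c1 &
    forall (f g u : 'rV[R]_n.+1 -> R) (U : 'rV[R]_n.+1 -> 'cV[R]_n.+1),
      in_Lp v Omega p f -> in_Lp v Omega p g ->
      weak_solution v Q Omega p F t f g u U ->
      (QLp_norm Q Omega p U <=
       c1%:E * (Lp_norm v Omega p f + Lp_norm v Omega p g))%E.
Proof.
have mO := open_lebesgue_measurable Omega Omega_open.
have [S _ SobS] := vQ_sobolev.
have [K K0 energy_le] := weak_solution_energy_le Omega p v Q mO p_gt1 v_meas v_ge0 Q_meas
  Q_psd F t S SobS F_adm t_subunit.
have [c0 c0_gt0 regular] := vQ_dirichlet.2 F t F_adm t_subunit.
pose k := (K * (2 + c0 `^ p)) `^ p^-1.
have k_ge0 : 0 <= k by exact: powR_ge0.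
(* [k] vanishes if [K] does; adding 1 makes the constant positive. *)
exists (k + 1); first exact: ltr_wpDl.
move=> f g u U fL gL sol.
have [[uL UL _] _] := sol.
have LpE h hL := Lp_normE Omega p v mO p_gt1 v_meas v_ge0 h hL.
have := regular f g u U fL gL sol.
rewrite (QLp_normE Omega p Q mO p_gt1 Q_meas Q_psd U UL).
rewrite (LpE f fL) (LpE g gL) (LpE u uL) -EFinD -!EFinM !lee_fin => u_le.
have E0 h : 0 <= Lp_energy Omega p v h by exact: Lp_energy_ge0.
apply: le_trans (root_energy_le p K c0 p_gt1 K0 (ltW c0_gt0)
  (QLp_energy_ge0 Omega p Q U) (E0 f) (E0 g) (E0 u)
  (energy_le f g u U fL gL sol) u_le) _.
by apply: ler_wpM2r; [rewrite addr_ge0 ?powR_ge0|rewrite lerDl].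
Qed.
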